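(* Let $C$ be a smooth curve and $P\in C$ a point with first (smallest positive) non-gap $a$, such that the first non-gap $b$ of $P$ that is not a multiple of $a$ is $b=na+r$ with $n\geq 1$, $0<r<a$; assume $\gcd(a,b)=1$ and $\dim|(n+1)aP|=n+2$. Let $Q\in C$ with $Q\neq P$ and $aQ\in|aP|$. If $\mathrm{WS}(P)$ does not contain the set $T$ of trivial new non-gaps associated to a cusp of type $(a-r;a)$ (i.e. $T\not\subseteq\mathrm{WS}(P)$), then $\mathrm{WS}(P)\neq\mathrm{WS}(Q)$.
   Context: Curves are smooth, irreducible, projective, over $\mathbb{C}$. For a point $P\in C$, $\mathrm{WS}(P)=\{0\}\cup\{m\in\mathbb{N}: |mP| \text{ is base point free}\}$, and its elements are the non-gaps of $P$. $|D|$ is the complete linear system of $D$ and $\dim|D|$ its projective dimension. Set $\mu=a-r$ (so $\gcd(a,\mu)=1$). For each integer $1\leq m\leq\mu-1$ let $n(m)$ be the integer with $(n(m)-1)\mu<ma<n(m)\mu$ (then $n(m)<a$). The set of trivial new non-gaps associated to a cusp of type $(\mu;a)$ is the set of integers $T=\{\,ib-ma : 1\leq m\leq\mu-1,\ n(m)\leq i\leq a-1\,\}$. *)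

(* Defs.v *)
From HB Require Import structures.
From mathcomp Require Import all_boot all_order all_algebra.
From mathcomp Require Import fraction generic_quotient ring_quotient.
From mathcomp Require Import mpoly.
From mathcomp Require Import boolp classical_sets reals complex.

Set Implicit Arguments.
Unset Strict Implicit.
Unset Printing Implicit Defensive.

Import GRing.Theory.
Local Open Scope ring_scope.

(** * Integral projective varieties

    A variety in P^N is Proj of k[X_0, ..., X_N] / I with I a homogeneous prime
    ideal; [eqs] is a finite family of homogeneous generators of I. *)

Record projVariety (k : closedFieldType) := ProjVariety {
  pdim : nat;
  pideal : prime_idealr {mpoly k[pdim.+1]};
  neqs : nat;
  eqs : 'I_neqs -> {mpoly k[pdim.+1]};
  eqs_homog : forall j, exists d : nat, eqs j \is d.-homog;
  eqs_gen : forall g : {mpoly k[pdim.+1]},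
    g \in (pideal : {pred _}) <->
    exists c : 'I_neqs -> {mpoly k[pdim.+1]}, g = \sum_j c j * eqs j
}.

Definition hcoord (k : closedFieldType) (X : projVariety k) : Type :=
  {ideal_quot (pideal X)}.

HB.instance Definition _ (k : closedFieldType) (X : projVariety k) :=
  GRing.ComNzRing.on (hcoord X).

Section HomogeneousCoordinateRing.
Variables (k : closedFieldType) (X : projVariety k).

Definition hcoord_unit : pred (hcoord X) :=
  fun x => `[< exists y : hcoord X, y * x = 1 >].

Definition hcoord_inv (x : hcoord X) : hcoord X :=
  xget x [set y : hcoord X | y * x = 1]%classic.

Fact hcoord_mulVx : {in hcoord_unit, left_inverse 1 hcoord_inv *%R}.
Proof.
move=> x /asboolP ex; rewrite /hcoord_inv.
by case: xgetP => [y _ //|no]; case: ex => y /no.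
Qed.

Fact hcoord_unitPl (x y : hcoord X) : y * x = 1 -> x \in hcoord_unit.
Proof. by move=> yx; apply/asboolP; exists y. Qed.

Fact hcoord_inv_out : {in [predC hcoord_unit], hcoord_inv =1 id}.
Proof.
move=> x /negP xN; rewrite /hcoord_inv.
by case: xgetP => [y _ yx|//]; case: xN; apply: (hcoord_unitPl yx).
Qed.

End HomogeneousCoordinateRing.

HB.instance Definition _ (k : closedFieldType) (X : projVariety k) :=
  GRing.ComNzRing_hasMulInverse.Build (hcoord X)
    (@hcoord_mulVx k X) (@hcoord_unitPl k X) (@hcoord_inv_out k X).

HB.instance Definition _ (k : closedFieldType) (X : projVariety k) :=
  GRing.ComUnitRing_isIntegral.Build (hcoord X)
    (@Quotient.rquot_IdomainAxiom _ (pideal X)).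

Section Variety.
Variables (k : closedFieldType) (X : projVariety k).

(** All fractions of the homogeneous coordinate ring; the function field k(X) is
    the subfield [ratfun] of fractions of degree 0. *)
Definition hfrac : fieldType := {fraction (hcoord X)}.

Definition cls (g : {mpoly k[(pdim X).+1]}) : hfrac :=
  tofrac (\pi_(hcoord X)%qT g : hcoord X).

Definition cst (c : k) : hfrac := cls c%:MP.

Definition ratfun : set hfrac := [set f | exists (d : nat) g h,
  [/\ g \is d.-homog, h \is d.-homog, h \notin (pideal X : {pred _})
    & f = cls g / cls h]]%classic.

Definition alg_indep (m : nat) (x : 'I_m -> hfrac) : Prop :=
  forall p : {mpoly k[m]}, p != 0 -> mmap cst x p != 0.

(** The dimension of X is the transcendence degree of k(X) over k. *)
Definition has_dim (d : nat) : Prop :=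
  (exists x : 'I_d -> hfrac, (forall i, ratfun (x i)) /\ alg_indep x) /\
  (forall x : 'I_d.+1 -> hfrac, (forall i, ratfun (x i)) -> ~ alg_indep x).

(** Points of P^N are the lines through the origin of k^(N+1); homogeneous
    polynomials are evaluated at the nonzero representative [vpick]. *)
Definition at_line (L : {vspace 'rV[k]_(pdim X).+1}) (i : 'I_(pdim X).+1) : k :=
  vpick L 0 i.

Definition on_variety : pred {vspace 'rV[k]_(pdim X).+1} :=
  fun L => (\dim L == 1)%N && [forall j, (@eqs k X j).@[at_line L] == 0].

Definition vpoint : choiceType := {L : {vspace 'rV[k]_(pdim X).+1} | on_variety L}.

Definition hom_coords (P : vpoint) : 'I_(pdim X).+1 -> k := at_line (val P).

Definition jacobian (P : vpoint) : 'M[k]_(neqs X, (pdim X).+1) :=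
  \matrix_(j < neqs X, i < (pdim X).+1) (mderiv i (@eqs k X j)).@[hom_coords P].

(** The Jacobian criterion: the rank is the codimension N - d at every point. *)
Definition is_smooth (d : nat) : Prop :=
  forall P : vpoint, (\rank (jacobian P) + d = pdim X)%N.

End Variety.

Arguments cls {k} X g.
Arguments cst {k} X c.
Arguments ratfun {k} X _.

Record smoothCurve (k : closedFieldType) := SmoothCurve {
  curve_variety :> projVariety k;
  curve_dim : has_dim curve_variety 1;
  curve_smooth : is_smooth curve_variety 1
}.

Section Curve.
Variables (k : closedFieldType) (X : smoothCurve k).
Local Open Scope classical_set_scope.

(** The local ring at P, its group of units and its maximal ideal, as subsets of
    k(X). *)
Definition local_ring (P : vpoint X) : set (hfrac X) := [set f | exists (d : nat) g h,
  [/\ g \is d.-homog, h \is d.-homog, h.@[hom_coords P] != 0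
    & f = cls X g / cls X h]].

Definition local_unit (P : vpoint X) : set (hfrac X) :=
  [set f | [/\ f != 0, local_ring P f & local_ring P f^-1]].

Definition local_max (P : vpoint X) : set (hfrac X) :=
  local_ring P `\` local_unit P.

Definition uniformizer (P : vpoint X) (t : hfrac X) : Prop :=
  local_max P = [set g * t | g in local_ring P].

(** [ord P f] is the n such that f = u t^n, with u a unit and t a uniformizer at P.
    It is used for nonzero f in k(X) only; elsewhere its value is junk. *)
Definition has_ord (P : vpoint X) (f : hfrac X) (n : int) : Prop :=
  exists t u, [/\ uniformizer P t, local_unit P u & f = u * t ^ n].

Definition ord (P : vpoint X) (f : hfrac X) : int := xget 0 (has_ord P f).

(** Divisors are given by their coefficients. Finite support is not recorded: only
    the divisors m P and members of their complete linear systems occur, and for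
    them it is automatic, because div(f) has finite support. *)
Definition divisor : Type := vpoint X -> int.

Definition mult_pt (m : nat) (P : vpoint X) : divisor :=
  fun S => if S == P then m%:Z else 0.

Definition linsys (D : divisor) : set divisor := [set E |
  (forall S, 0 <= E S) /\
  exists f : hfrac X, [/\ ratfun X f, f != 0 & forall S, E S = D S + ord S f]].

Definition rrspace (D : divisor) : set (hfrac X) := [set f |
  ratfun X f /\ (f != 0 -> forall S, 0 <= D S + ord S f)].

(** |D| is the projective space of lines of L(D), so dim |D| = d means that L(D)
    has a k-basis with d + 1 elements. *)
Definition linsys_dim (D : divisor) (d : nat) : Prop :=
  exists e : 'I_d.+1 -> hfrac X,
  [/\ forall i, rrspace D (e i),
      forall c : 'I_d.+1 -> k, \sum_i cst X (c i) * e i = 0 -> forall i, c i = 0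
    & forall f, rrspace D f ->
        exists c : 'I_d.+1 -> k, f = \sum_i cst X (c i) * e i].

Definition base_point_free (D : divisor) : Prop :=
  forall S : vpoint X, exists2 E, linsys D E & E S = 0.

Definition WS (P : vpoint X) : set nat :=
  [set m | m = 0%N \/ base_point_free (mult_pt m P)].

Definition first_nongap (P : vpoint X) (a : nat) : Prop :=
  [/\ (0 < a)%N, WS P a & forall m, (0 < m)%N -> WS P m -> (a <= m)%N].

Definition first_nongap_not_multiple (P : vpoint X) (a b : nat) : Prop :=
  [/\ WS P b, ~~ (a %| b)%N & forall m, WS P m -> ~~ (a %| m)%N -> (b <= m)%N].

End Curve.

(** The set of integers i b - m a with 1 <= m <= mu - 1 and n(m) <= i <= a - 1,
    where nm = n(m) is determined by (nm - 1) mu < m a < nm mu. *)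
Definition trivial_nongaps (mu a b : nat) : set int := [set z : int |
  exists m i nm : nat,
  [/\ (1 <= m <= mu - 1)%N,
      ((nm%:Z - 1) * mu%:Z < m%:Z * a%:Z) && (m%:Z * a%:Z < nm%:Z * mu%:Z),
      (nm <= i <= a - 1)%N
    & z = i%:Z * b%:Z - m%:Z * a%:Z]]%classic.

(* Main.v *)
Require Import Defs.
From HB Require Import structures.
From mathcomp Require Import all_boot all_order all_algebra.
From mathcomp Require Import fraction generic_quotient ring_quotient.
From mathcomp Require Import mpoly zify ring.
From mathcomp Require Import boolp classical_sets reals complex.

(** Let f have divisor aQ - aP, and suppose WS P = WS Q. A function h with polar
    divisor bQ gives h f^(n+1) in L((n+1)aP), vanishing at Q to order
    (n+1)a - b = a - r. This space has basis 1, f, ..., f^(n+1), g with g of polar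
    divisor bP; comparing orders at P and at Q in the linear relation expressing
    h f^(n+1), and removing the term in f^(n+1), one gets w with polar divisor bP
    and a zero of order a - r at Q. The functions w^i / f^m then realise all the
    trivial new non-gaps at P.

    That [ord] is a valuation needs no Noetherian argument: where a uniformizer t is
    nonzero, a nonzero element of the local ring is not divisible by all powers of
    t because it is algebraically dependent on t; at other points [ord] is 0 on
    nonzero functions. *)

Set Implicit Arguments.
Unset Strict Implicit.
Unset Printing Implicit Defensive.

Import Order.TTheory GRing.Theory Num.Theory.
Local Open Scope ring_scope.
Local Open Scope classical_set_scope.

(** * Order function of a ring, measured by a generator of its nonunits *)

Section ValuationRing.
Variables (K : fieldType) (A : set K).
Implicit Types (f g t u v : K) (n : int).

(** With [A] the local ring at [P], [units_of], [generates_nonunits], [has_ringval] and [ringval]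
    are convertible to [local_unit], [uniformizer], [has_ord] and [ord], so results proved here
    transfer to [ord] directly. *)
Definition units_of : set K := [set f | [/\ f != 0, A f & A f^-1]].

Definition generates_nonunits t : Prop :=
  A `\` units_of = [set g * t | g in A].

Definition has_ringval f n : Prop :=
  exists t u, [/\ generates_nonunits t, units_of u & f = u * t ^ n].

Definition ringval f : int := xget 0 (has_ringval f).

Hypothesis A1 : A 1.
Hypothesis AN : forall f, A f -> A (- f).
Hypothesis AD : forall f g, A f -> A g -> A (f + g).
Hypothesis AM : forall f g, A f -> A g -> A (f * g).

Let A0 : A 0.
Proof. by rewrite -(subrr 1); apply: AD => //; exact: AN. Qed.

Let AX f m : A f -> A (f ^+ m).
Proof. by move=> Af; elim: m => [|m IH]; rewrite ?expr0 // exprS; exact: AM. Qed.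

Lemma units_of1 : units_of 1.
Proof. by split; rewrite ?invr1 ?oner_neq0. Qed.

Lemma units_ofM f g : units_of f -> units_of g -> units_of (f * g).
Proof.
by move=> [f0 Af AfV] [g0 Ag AgV]; split; rewrite ?mulf_neq0 ?invfM //; exact: AM.
Qed.

Lemma units_ofV f : units_of f -> units_of f^-1.
Proof. by move=> [f0 Af AfV]; split; rewrite ?invr_eq0 ?invrK. Qed.

Lemma generator_nonunit t : generates_nonunits t -> A t /\ ~ units_of t.
Proof.
by move=> tM; suff : (A `\` units_of) t by []; rewrite tM; exists 1; rewrite ?mul1r.
Qed.

Lemma generator_mul_nonunit t f : generates_nonunits t -> A f -> ~ units_of (f * t).
Proof.
by move=> tM Af; have : (A `\` units_of) (f * t) by [rewrite tM; exists f|]; case.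
Qed.

Lemma nonunit_divides t f : generates_nonunits t -> A f -> ~ units_of f ->
  exists2 g, A g & f = g * t.
Proof.
move=> tM Af fU; have : (A `\` units_of) f by [].
by rewrite tM => -[g Ag <-]; exists g.
Qed.

(* The lexicographically least term of a relation between [f] and [t] would be
   divisible by [t] times itself if [f] were divisible by all powers of [t]. *)
Lemma algebraic_separated (k : fieldType) (c : {rmorphism k -> K}) t f
    (x := fun i : 'I_2 => if i == 0 then f else t) (p : {mpoly k[2]}) :
  (forall a, A (c a)) -> generates_nonunits t -> t != 0 -> A f -> f != 0 ->
  p != 0 -> mmap c x p = 0 ->
  exists j, forall g, A g -> f <> g * t ^+ j.
Proof.
move=> Ac tM t0 Af f0 p0 px0; apply: contrapT => /forallNP fdiv.
have {}fdiv j : exists2 g, A g & f = g * t ^+ j.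
  apply: contrapT => nf; apply: (fdiv j) => g Ag fg; apply: nf.
  by exists g.
have [At _] := generator_nonunit tM.
(* The lexicographic minimum is found in two stages: the exponent of [f] first, then that of [t]
   among the monomials attaining it. *)
have [e0 e0P e0min] : exists2 e, exists2 m, m \in msupp p & m ord0 = e &
    forall m, m \in msupp p -> (e <= m ord0)%N.
  have ex : exists e, `[< exists2 m, m \in msupp p & m ord0 = e >].
    case E : (msupp p) => [|m s]; first by rewrite -msupp_eq0 E in p0.
    by exists (m ord0); apply/asboolP; exists m; rewrite ?inE ?eqxx.
  case: (ex_minnP ex) => e /asboolP eP emin; exists e => // m pm.
  by apply: emin; apply/asboolP; exists m.
have [m0 pm0 m0min] : exists2 m0, m0 \in msupp p & forall m, m \in msupp p ->
    m != m0 -> (m0 ord0 < m ord0)%N \/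
      m0 ord0 = m ord0 /\ (m0 ord_max < m ord_max)%N.
  have ex : exists e, `[< exists m,
      [/\ m \in msupp p, m ord0 = e0 & m ord_max = e] >].
    by case: e0P => m pm m0; exists (m ord_max); apply/asboolP; exists m.
  case: (ex_minnP ex) => e /asboolP[m0 [pm0 m00 m01]] emin; exists m0 => // m pm.
  move=> mm0; have := e0min m pm; rewrite leq_eqVlt m00.
  case/orP=> [/eqP me|]; last by left.
  right; split=> //; rewrite m01 ltn_neqAle emin ?andbT; last first.
    by apply/asboolP; exists m; rewrite -me.
  apply: contra_neq mm0 => me1; apply/mnmP => i.
  have /orP[/eqP->|/eqP->] : (i == ord0) || (i == ord_max) by case: i => [[|[|]]].
  - by rewrite m00.
  - by rewrite m01.
have mm1 m : mmap1 x m = f ^+ m ord0 * t ^+ m ord_max.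
  rewrite /mmap1 big_ord_recr big_ord1 /x /=.
  by congr (f ^+ _ * t ^+ _); congr (m _); apply: val_inj.
move: px0; rewrite /mmap (bigD1_seq m0) //= mm1.
pose B := f ^+ m0 ord0 * t ^+ m0 ord_max.
have B0 : B != 0 by rewrite mulf_neq0 ?expf_neq0.
have [g Ag ->] : exists2 g, A g &
    \sum_(m <- msupp p | m != m0) c p@_m * mmap1 x m = B * (g * t).
  rewrite big_seq_cond.
  elim/big_rec: _ => [|m s /andP[pm mm0] [g Ag ->]].
    by exists 0; rewrite ?mul0r ?mulr0.
  suff [h Ah ->] : exists2 h, A h & mmap1 x m = B * (h * t).
    exists (c p@_m * h + g); first by apply: AD => //; exact: AM.
    by ring.
  (* If [m] has the larger exponent of [f], one factor [f] is traded for a multiple of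
     [t ^+ (m0 ord_max).+1], which supplies the [t]-part of [B] and one more [t]. Otherwise the
     extra [t] comes from the exponent of [t] in [m]. *)
  rewrite mm1; case: (m0min m pm mm0) => [lt0|[<- lt1]].
    have [g' Ag' fg'] := fdiv (m0 ord_max).+1.
    exists (g' * (f ^+ (m ord0 - m0 ord0).-1 * t ^+ m ord_max)).
      by do !apply: AM => //; exact: AX.
    have -> : m ord0 = (m0 ord0 + (m ord0 - m0 ord0).-1.+1)%N by lia.
    have -> : ((m0 ord0 + (m ord0 - m0 ord0).-1.+1 - m0 ord0) =
      (m ord0 - m0 ord0).-1.+1)%N by lia.
    by rewrite exprD [f ^+ _.+1]exprS {2}fg' [t ^+ _.+1]exprS /B /=; ring.
  exists (t ^+ (m ord_max - m0 ord_max).-1); first exact: AX.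
  by rewrite -exprSr prednK ?subn_gt0 // /B -mulrA -exprD subnKC //; exact: ltnW.
(* Cancelling [B] leaves a nonzero constant equal to [- g * t]: a unit that would be a nonunit. *)
rewrite [c _ * _]mulrC -mulrDr => /eqP; rewrite mulf_eq0 (negPf B0) /=.
rewrite addr_eq0 -mulNr => /eqP cgt.
apply: (@generator_mul_nonunit t (- g)) => //; first exact: AN.
have cm0 : c p@_m0 != 0 by rewrite fmorph_eq0 -mcoeff_msupp.
by rewrite -cgt; split; rewrite -?fmorphV.
Qed.

Section Generator.
Variable t : K.
Hypotheses (tM : generates_nonunits t) (t0 : t != 0).
Hypothesis separated : forall f, A f -> f != 0 ->
  exists j, forall g, A g -> f <> g * t ^+ j.

Lemma expr_generator_nonunit m : (0 < m)%N -> ~ units_of (t ^+ m).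
Proof.
case: m => // m _; rewrite exprSr; apply: generator_mul_nonunit => //.
by apply: AX; have [] := generator_nonunit tM.
Qed.

Lemma expz_generator_unit n : units_of (t ^ n) -> n = 0.
Proof.
case: n => [[//|m]|m] U; exfalso.
  exact: (@expr_generator_nonunit m.+1).
apply: (@expr_generator_nonunit m.+1) => //.
by rewrite -[t ^+ _]invrK; exact: units_ofV U.
Qed.

(** Each generator is a nonunit, hence a multiple of the other, and [t != 0] makes the two cofactors
    inverse to each other. So the exponent in a representation will not depend on the generator. *)
Lemma generator_assoc t' : generates_nonunits t' ->
  t' != 0 /\ exists2 w, units_of w & t' = w * t.
Proof.
move=> tM'; have [At nt] := generator_nonunit tM.
have [At' nt'] := generator_nonunit tM'.
have [w Aw wE] := nonunit_divides tM At' nt'.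
have [w' Aw' w'E] := nonunit_divides tM' At nt.
have t'0 : t' != 0 by apply: contra_neq t0 => t'0; rewrite w'E t'0 mulr0.
split=> //; exists w => //.
have ww : w' * w = 1 by apply: (mulIf t0); rewrite mul1r -mulrA -wE.
have w0 : w != 0 by apply: contra_eq_neq ww => ->; rewrite mulr0 eq_sym oner_neq0.
by split=> //; rewrite -[w^-1]mul1r -ww mulfK.
Qed.

Lemma units_ofX w m : units_of w -> units_of (w ^+ m).
Proof.
move=> Uw; elim: m => [|m IH]; first exact: units_of1.
by rewrite exprS; exact: units_ofM.
Qed.

Lemma units_ofXz w n : units_of w -> units_of (w ^ n).
Proof.
case: n => m Uw; first exact: units_ofX.
by apply: (@units_ofV (w ^+ m.+1)); exact: units_ofX.
Qed.

(** [xget] may select a representation by another generator, with exponent [m]. Comparing it with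
    the given one exhibits [t ^ (n - m)] as a unit, which forces [n = m]. *)
Lemma ringvalE u n : units_of u -> ringval (u * t ^ n) = n.
Proof.
move=> Uu; rewrite /ringval; case: xgetP => [m _|/(_ n)/=]; last by case; exists t, u.
move=> [t' [v [tM' Uv uv]]]; have [t'0 [w Uw tw]] := generator_assoc tM'.
have u0 : u != 0 by case: Uu.
apply/eqP; rewrite eq_sym -subr_eq0; apply/eqP/expz_generator_unit.
have -> : t ^ (n - m) = u^-1 * (v * w ^ m).
  rewrite expfzDr // -invr_expz; apply: (mulfI u0).
  rewrite mulrA uv tw exprzMl ?mulVKf //.
    by rewrite -!mulrA mulfV ?mulr1 // expfz_neq0.
  - by case: Uw => w0 _ _; rewrite unitfE.
  - by rewrite unitfE.
by apply: units_ofM; [exact: units_ofV|apply: units_ofM => //; exact: units_ofXz].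
Qed.

(** The least exponent for which the power of [t] does not divide [f] is positive. The cofactor of
    the preceding power is not divisible by [t], so it is a unit. *)
Lemma ring_factor f : A f -> f != 0 ->
  exists u m, units_of u /\ f = u * t ^+ m.
Proof.
move=> Af f0; have [j0 jP] := separated Af f0.
have ex : exists j, `[< forall g, A g -> f <> g * t ^+ j >].
  by exists j0; apply/asboolP.
case: (ex_minnP ex) => -[|j] /asboolP fj jmin.
  by case: (fj f) => //; rewrite expr0 mulr1.
have [u Au uE] : exists2 g, A g & f = g * t ^+ j.
  apply: contrapT => nf; suff : (j < j)%N by rewrite ltnn.
  by apply: jmin; apply/asboolP => g Ag fg; apply: nf; exists g.
exists u, j; split=> //; apply: contrapT => nu.
have [g Ag gE] := nonunit_divides tM Au nu.
by apply: (fj g Ag); rewrite uE gE exprS mulrA.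
Qed.

Lemma frac_factor f g : A f -> A g -> f / g != 0 ->
  exists u n, units_of u /\ f / g = u * t ^ n.
Proof.
move=> Af Ag fg0.
have f0 : f != 0 by apply: contra_neq fg0 => ->; rewrite mul0r.
have g0 : g != 0 by apply: contra_neq fg0 => ->; rewrite invr0 mulr0.
have [u [m [Uu ->]]] := ring_factor Af f0.
have [v [l [Uv ->]]] := ring_factor Ag g0.
exists (u / v), (m%:Z - l%:Z); split.
  by apply: units_ofM => //; exact: units_ofV.
by rewrite expfzDr // -invr_expz invfM mulrACA.
Qed.

End Generator.

Hypothesis separated : forall t f, generates_nonunits t -> t != 0 -> A f ->
  f != 0 -> exists j, forall g, A g -> f <> g * t ^+ j.

Variable F : set K.
Hypothesis Ffrac : forall f, F f -> exists g h, [/\ A g, A h & f = g / h].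

(* Where no element generates the nonunits, or where only 0 does, [ringval] is 0. *)
Lemma ringval_dichotomy : (forall f, f != 0 -> ringval f = 0) \/
  exists t, [/\ generates_nonunits t, t != 0 &
    forall f, F f -> f != 0 -> exists u n, units_of u /\ f = u * t ^ n].
Proof.
have [[t [tM t0]]|nt] := pselect (exists t, generates_nonunits t /\ t != 0).
  right; exists t; split=> // f /Ffrac[g [h [Ag Ah ->]]] f0.
  by apply: frac_factor => // g' Ag' g'0; exact: separated.
(* Without a representation [xget] returns its default 0. Otherwise the generator is 0, and as
   [0 ^ n] vanishes for every nonzero [n], a nonzero [f] forces [n = 0]. *)
left=> f f0; rewrite /ringval; case: xgetP => // n _ [t [u [tM Uu fE]]].
have [t0|t0] := eqVneq t 0; last by case: nt; exists t.
apply/eqP; apply: contra_neqT f0 => n0.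
by rewrite fE t0 exp0rz (negPf n0) mulr0.
Qed.

Lemma ringval_unit u : units_of u -> ringval u = 0.
Proof.
move=> Uu; have u0 : u != 0 by case: Uu.
have [->//|[t [tM t0 _]]] := ringval_dichotomy.
by have := ringvalE tM t0 0 Uu; rewrite expr0z mulr1.
Qed.

Lemma ringvalM f g : F f -> F g -> f != 0 -> g != 0 ->
  ringval (f * g) = ringval f + ringval g.
Proof.
move=> Ff Fg f0 g0; have [v0|[t [tM t0 fact]]] := ringval_dichotomy.
  by rewrite !v0 ?addr0 // mulf_neq0.
have [u [n [Uu ->]]] := fact f Ff f0; have [v [m [Uv ->]]] := fact g Fg g0.
by rewrite mulrACA -expfzDr // !ringvalE //; exact: units_ofM.
Qed.

Lemma ringvalD n f g : F f -> F g -> f != 0 -> g != 0 -> f + g != 0 ->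
  n <= ringval f -> n <= ringval g -> n <= ringval (f + g).
Proof.
move=> Ff Fg f0 g0 fg0; have [v0|[t [tM t0 fact]]] := ringval_dichotomy.
  by rewrite !v0.
wlog le_fg : f g Ff Fg f0 g0 fg0 / ringval f <= ringval g.
  move=> IH nf ng; have [|lt] := lerP (ringval f) (ringval g); first by move/IH; apply.
  by rewrite addrC; apply: (IH g f) => //; rewrite 1?addrC //; exact: ltW.
move=> nf _; apply: (le_trans nf); move: le_fg fg0.
have [u [i [Uu ->]]] := fact f Ff f0; have [v [j [Uv ->]]] := fact g Fg g0.
rewrite !ringvalE // => le_ij.
have [At _] := generator_nonunit tM.
have [l ->] : exists l : nat, j = i + l%:Z by exists `|j - i|%N; lia.
rewrite expfzDr // mulrCA [u * _]mulrC -mulrDr => fg0.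
have s0 : u + v * t ^ l != 0 by apply: contra_neq fg0 => ->; rewrite mulr0.
(* Once the smaller power of [t] is factored out, the cofactor lies in [A], so [ring_factor] gives
   it a natural exponent. *)
have As : A (u + v * t ^ l).
  by case: Uu Uv => [_ Au _] [_ Av _]; apply: AD => //; apply: AM => //; exact: AX.
have [w [m [Uw ->]]] := ring_factor tM (fun g => @separated t g tM t0) As s0.
by rewrite mulrCA -[t ^+ m]/(t ^ m) -expfzDr // ringvalE //; lia.
Qed.

End ValuationRing.

(** * Linear algebra with valuations that are trivial on constants *)

Section Valuations.
Variables (k K : fieldType) (c : {rmorphism k -> K}) (F : set K).
Implicit Types (f g u w : K) (n : int) (v : K -> int).

(** Zero is excluded throughout because [ord] has a junk value there. [F] stands for the function
    field, which sits inside the larger field [K] of all fractions of the homogeneous coordinate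
    ring. *)
Definition is_valuation v : Prop :=
  [/\ forall f g, F f -> F g -> f != 0 -> g != 0 -> v (f * g) = v f + v g,
      forall n f g, F f -> F g -> f != 0 -> g != 0 -> f + g != 0 ->
        n <= v f -> n <= v g -> n <= v (f + g)
    & forall x, x != 0 -> v (c x) = 0].

(** Zero belongs to the set, as if its value were infinite; this is what makes the set closed under
    addition. *)
Definition val_ge v n : set K := [set f | F f /\ (f != 0 -> n <= v f)].

Hypothesis Fc : forall x, F (c x).
Hypothesis FD : forall f g, F f -> F g -> F (f + g).
Hypothesis FM : forall f g, F f -> F g -> F (f * g).
Hypothesis FV : forall f, F f -> F f^-1.

Let F1 : F 1.
Proof. by rewrite -(rmorph1 c). Qed.

Let FX f m : F f -> F (f ^+ m).
Proof. by move=> Ff; elim: m => [|m IH]; rewrite ?expr0 // exprS; exact: FM. Qed.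

Section OneValuation.
Variable v : K -> int.
Hypothesis vP : is_valuation v.

Lemma val_expr f m : F f -> f != 0 -> v (f ^+ m) = m%:Z * v f.
Proof.
case: vP => vM _ vc Ff f0; elim: m => [|m IH].
  by rewrite expr0 mul0r -(rmorph1 c) vc ?oner_neq0.
by rewrite exprS vM ?expf_neq0 ?IH //; [lia|exact: FX].
Qed.

Lemma val_inv f : F f -> f != 0 -> v f^-1 = - v f.
Proof.
case: vP => vM _ vc Ff f0; apply/eqP.
rewrite -addr_eq0 -vM ?invr_eq0 //; last exact: FV.
by rewrite mulVf // -(rmorph1 c) vc ?oner_neq0.
Qed.

Lemma val_geW n m f : n <= m -> val_ge v m f -> val_ge v n f.
Proof. by move=> nm [Ff mf]; split=> // /mf; exact: le_trans. Qed.

Lemma val_ge0 n : val_ge v n 0.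
Proof. by split; rewrite ?eqxx // -(rmorph0 c). Qed.

Lemma val_geD n f g : val_ge v n f -> val_ge v n g -> val_ge v n (f + g).
Proof.
move=> [Ff nf] [Fg ng]; split=> [|fg0]; first exact: FD.
have [f0|f0] := eqVneq f 0; first by move: fg0; rewrite f0 add0r.
have [g0|g0] := eqVneq g 0; first by move: fg0; rewrite g0 addr0.
by case: vP => _ vD _; apply: vD => //; [exact: nf|exact: ng].
Qed.

Lemma val_geM n m f g : val_ge v n f -> val_ge v m g -> val_ge v (n + m) (f * g).
Proof.
move=> [Ff nf] [Fg mg]; split=> [|]; first exact: FM.
rewrite mulf_eq0 negb_or => /andP[f0 g0]; case: vP => vM _ _.
by rewrite vM // lerD ?nf ?mg.
Qed.

Lemma val_ge_cst x : val_ge v 0 (c x).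
Proof. by split=> //; rewrite fmorph_eq0 => x0; case: vP => _ _ ->. Qed.

Lemma val_geZ n x f : val_ge v n f -> val_ge v n (c x * f).
Proof. by rewrite -{2}[n]add0r; apply: val_geM; exact: val_ge_cst. Qed.

Lemma val_ge_sum n (J : finType) (p : pred J) (x : J -> k) (y : J -> K) :
  (forall j, p j -> val_ge v n (y j)) ->
  val_ge v n (\sum_(j | p j) c (x j) * y j).
Proof.
move=> ny; elim/big_ind: _ => [|f g|j pj]; first exact: val_ge0.
  exact: val_geD.
by apply: val_geZ; exact: ny.
Qed.

(** Were [f + g] in [val_ge v (v f + 1)], which contains 0, then [f = (f + g) - g] would be there
    too. *)
Lemma val_dominant f g : F f -> f != 0 -> val_ge v (v f + 1) g ->
  f + g != 0 /\ v (f + g) = v f.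
Proof.
move=> Ff f0 gt; have FN : F (- g).
  by rewrite -mulN1r -(rmorphN1 c); apply: FM => //; case: gt.
have not_gt : ~ val_ge v (v f + 1) f by case=> _ /(_ f0); lia.
have gtN : val_ge v (v f + 1) (- g).
  by rewrite -mulN1r -(rmorphN1 c); exact: val_geZ.
have nge : ~ val_ge v (v f + 1) (f + g).
  by move=> ge; apply: not_gt; rewrite -[X in val_ge _ _ X](addrK g); exact: val_geD.
have fg0 : f + g != 0.
  by apply: contra_notN nge => /eqP->; exact: val_ge0.
have [_ /(_ fg0) ge] : val_ge v (v f) (f + g).
  by apply: val_geD; [split|apply: val_geW gt; lia].
split=> //; apply/eqP; rewrite eq_le ge andbT leNgt; apply/negP => lt.
by apply: nge; split=> [|_]; [apply: FD; case: gt|lia].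
Qed.

(** Among the terms with nonzero coefficient, the one of least value is unique by injectivity and
    dominates the others, so the sum cannot vanish. *)
Lemma val_inj_independent (J : finType) (y : J -> K) (x : J -> k) :
  (forall j, F (y j)) -> (forall j, y j != 0) -> injective (v \o y) ->
  \sum_j c (x j) * y j = 0 -> forall j, x j = 0.
Proof.
move=> Fy y0 vinj xy0 j1; apply/eqP/negPn/negP => xj1.
pose j0 := [arg min_(j < j1 | x j != 0) v (y j)]%O.
have [xj0 j0min] : x j0 != 0 /\ forall j, x j != 0 -> v (y j0) <= v (y j).
  by rewrite /j0; case: arg_minP.
have vxy : v (c (x j0) * y j0) = v (y j0).
  by case: vP => vM _ vc; rewrite vM ?fmorph_eq0 // vc // add0r.
have [] := @val_dominant (c (x j0) * y j0) (\sum_(j | j != j0) c (x j) * y j).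
- exact: FM.
- by rewrite mulf_neq0 ?fmorph_eq0.
- rewrite vxy; elim/big_ind: _ => [|f g|j jj0]; first exact: val_ge0.
    exact: val_geD.
  have [->|xj] := eqVneq (x j) 0; first by rewrite rmorph0 mul0r; exact: val_ge0.
  apply: val_geZ; split=> // _; have := j0min j xj; rewrite le_eqVlt.
  case/orP=> [/eqP e|]; last lia.
  by case/eqP: jj0; apply: vinj.
- by move: xy0; rewrite (bigD1 j0) //= => ->; rewrite eqxx.
Qed.

End OneValuation.

(** The matrix of coefficients in [e] has more rows than columns, hence a nonzero left kernel, whose
    entries are the coefficients of the relation. *)
Lemma span_dependent (d : nat) (e : 'I_d -> K) (J : finType) (y : J -> K) :
  (d < #|J|)%N -> (forall j, exists x : 'I_d -> k, y j = \sum_i c (x i) * e i) ->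
  exists x : J -> k, (exists j, x j != 0) /\ \sum_j c (x j) * y j = 0.
Proof.
move=> dJ /choice[M yE].
pose A : 'M[k]_(#|J|, d) := \matrix_(j, i) M (enum_val j) i.
have : kermx A != 0.
  rewrite kermx_eq0 /row_free; apply/eqP => rA; have := rank_leq_col A.
  by rewrite rA leqNgt dJ.
case/rowV0Pn => u /sub_kermxP uA u0.
exists (fun j => u 0 (enum_rank j)); split.
  apply: contrapT => /forallNP u_0; case/eqP: u0; apply/rowP => j; rewrite mxE.
  by apply: contrapT => /eqP uj; apply: (u_0 (enum_val j)); rewrite enum_valK.
under eq_bigr do rewrite yE mulr_sumr.
rewrite exchange_big big1 //= => i _.
transitivity (c ((u *m A) 0 i) * e i); last by rewrite uA mxE rmorph0 mul0r.
rewrite mxE rmorph_sum mulr_suml (reindex_onto enum_rank enum_val) /=; last first.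
  by move=> j _; exact: enum_valK.
apply: eq_big => [j|j _]; first by rewrite enum_rankK eqxx.
by rewrite mxE enum_rankK rmorphM mulrA.
Qed.

(** * A function with its only pole at one point and a prescribed zero at another *)

Section TwoPoints.
Variables (S : eqType) (ord : S -> K -> int).
Hypothesis ordP : forall s, is_valuation (ord s).

(** The hypothesis [span] places L((n + 1) a p) in the span of n + 3 functions; it comes from the
    assumption that the projective dimension is n + 2. *)
Lemma cusp_function (p q : S) (a b n r : nat) (f g h : K)
    (e : 'I_(n + 2).+1 -> K) :
  q != p -> b = (n * a + r)%N -> (0 < r < a)%N ->
  (forall u, F u ->
    (u != 0 -> forall s, 0 <= (if s == p then ((n + 1) * a)%:Z else 0) + ord s u) ->
    exists x : 'I_(n + 2).+1 -> k, u = \sum_i c (x i) * e i) ->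
  F f -> f != 0 -> ord p f = - a%:Z -> ord q f = a%:Z ->
  (forall s, s != p -> s != q -> ord s f = 0) ->
  F g -> g != 0 -> ord p g = - b%:Z -> (forall s, s != p -> 0 <= ord s g) ->
  F h -> h != 0 -> ord q h = - b%:Z -> (forall s, s != q -> 0 <= ord s h) ->
  exists w, [/\ F w, w != 0, ord p w = - b%:Z, ord q w = a%:Z - r%:Z &
    forall s, s != p -> 0 <= ord s w].
Proof.
move=> qp bE ra span Ff f0 fp fq fs Fg g0 gp gs Fh h0 hq hs.
have pq : p != q by rewrite eq_sym.
(* The exponent [n.+1] is the least one that turns the pole of [h] at [q] into a zero. *)
pose g1 := h * f ^+ n.+1.
have Fg1 : F g1 by apply: FM => //; exact: FX.
have g10 : g1 != 0 by rewrite mulf_neq0 ?expf_neq0.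
have fX0 m : f ^+ m != 0 by rewrite expf_neq0.
have ordX s m : ord s (f ^+ m) = m%:Z * ord s f by exact: val_expr.
have ordg1 s : ord s g1 = ord s h + n.+1%:Z * ord s f.
  by case: (ordP s) => vM _ _; rewrite vM // ?ordX //; exact: FX.
have b_div i : (i * a)%N <> b.
  case/andP: ra => r0 ra; rewrite bE => /(congr1 (modn^~ a)).
  by rewrite modnMl modnMDl modn_small //; lia.
(* These are n + 4 functions in the span of n + 3, so a nontrivial relation exists. *)
pose y (j : option (option 'I_n.+2)) : K :=
  match j with None => g | Some None => g1 | Some (Some i) => f ^+ i end.
have [x [[j xj]]] : exists x, (exists j, x j != 0) /\ \sum_j c (x j) * y j = 0.
  apply: (@span_dependent _ e); first by rewrite !card_option card_ord; lia.
  move=> j; apply: span => [|_ s]; first by case: j => [[i|]|] //=; exact: FX.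
  have [->|sp] := eqVneq s p.
    case: j => [[i|]|] /=; rewrite ?ordX ?ordg1 ?fp ?gp; last nia.
      by have := ltn_ord i; nia.
    by have := hs p pq; nia.
  have [->|sq] := eqVneq s q.
    case: j => [[i|]|] /=; rewrite ?ordX ?ordg1 ?fq ?hq; first nia.
      by nia.
    by rewrite add0r gs.
  by case: j => [[i|]|] /=; rewrite ?ordX ?ordg1 ?fs // ?mulr0 ?addr0 ?add0r ?gs ?hs.
have big_option (I : finType) (E : option I -> K) :
    \sum_j E j = E None + \sum_i E (Some i).
  rewrite (bigD1 None) //=; congr (_ + _).
  rewrite (reindex_omap Some id) => [|[]//]; by apply: eq_bigl => i; rewrite /= eqxx.
rewrite !big_option /= => rel.
set al := x None in rel; set be := x (Some None) in rel.
pose ga i := x (Some (Some i)); rewrite -/(ga _) in rel.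
have f_inj s : ord s f != 0 -> injective (fun i : 'I_n.+2 => ord s (f ^+ i)).
  move=> sf i j'; rewrite !ordX => /(mulIf sf) [ij]; exact: val_inj.
(* Without [g1] only [g] and powers of [f] remain. Their orders at [p], namely -b and the -i a, are
   distinct since [a] does not divide [b]. *)
have be0 : be != 0.
  apply/eqP => be0; move: xj; apply/negP/negPn/eqP.
  pose z (i : option 'I_n.+2) := if i is Some i then f ^+ i else g.
  pose xz (i : option 'I_n.+2) := if i is Some i then ga i else al.
  have xz0 : forall i, xz i = 0.
    apply: (@val_inj_independent _ (ordP p) _ z) => [[i|]|[i|]|[i|] [i'|]|] //=.
    - exact: FX.
    - by move=> /f_inj ->//; rewrite fp; lia.
    - by rewrite ordX fp gp => ib; case: (b_div i); nia.
    - by rewrite ordX fp gp => ib; case: (b_div i'); nia.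
    - by move: rel; rewrite big_option /= be0 rmorph0 mul0r add0r.
  by case: j => [[i|]|]; [exact: (xz0 (Some i))|exact: be0|exact: (xz0 None)].
(* Without [g] the orders at [q] are the i a and (n + 1) a - b, distinct for the same reason. *)
have al0 : al != 0.
  apply/eqP => al0; move: xj; apply/negP/negPn/eqP.
  pose z (i : option 'I_n.+2) := if i is Some i then f ^+ i else g1.
  pose xz (i : option 'I_n.+2) := if i is Some i then ga i else be.
  have xz0 : forall i, xz i = 0.
    apply: (@val_inj_independent _ (ordP q) _ z) => [[i|]|[i|]|[i|] [i'|]|] //=.
    - exact: FX.
    - by move=> /f_inj ->//; rewrite fq; lia.
    - rewrite ordX ordg1 fq hq => ib.
      have ib' : i%:Z * a%:Z + b%:Z = n.+1%:Z * a%:Z by lia.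
      have lin : (i <= n.+1)%N by have := ltn_ord i; lia.
      by case: (b_div (n.+1 - i)%N); rewrite mulnBl; lia.
    - rewrite ordX ordg1 fq hq => ib.
      have ib' : i'%:Z * a%:Z + b%:Z = n.+1%:Z * a%:Z by lia.
      have lin : (i' <= n.+1)%N by have := ltn_ord i'; lia.
      by case: (b_div (n.+1 - i')%N); rewrite mulnBl; lia.
    - by move: rel; rewrite big_option /= al0 rmorph0 mul0r add0r.
  by case: j => [[i|]|]; [exact: (xz0 (Some i))|exact: (xz0 None)|exact: al0].
(* By the relation, [w] is a combination of [g] and the powers [f ^+ i] with i <= n, so at [p] the
   term in [g] dominates because n a < b. At [q] the added term has order (n + 1) a > a - r and
   leaves the order of [g1] unchanged. *)
pose w := g1 + c (be^-1 * ga ord_max) * f ^+ n.+1.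
have wE : w = c (- (be^-1 * al)) * g +
    \sum_(i < n.+1) c (- (be^-1 * ga (widen_ord (leqnSn n.+1) i))) * f ^+ i.
  have cbe0 : c be != 0 by rewrite fmorph_eq0.
  move: rel; rewrite big_ord_recr /= => rel.
  apply: (mulfI cbe0); rewrite /w !mulrDr mulr_sumr.
  have cb z t : c be * (c (be^-1 * z) * t) = c z * t.
    by rewrite mulrA -rmorphM mulVKf.
  have cbN z t : c be * (c (- (be^-1 * z)) * t) = - (c z * t).
    by rewrite rmorphN mulNr mulrN cb.
  rewrite cb cbN; under eq_bigr do rewrite cbN.
  rewrite sumrN -opprD; apply/eqP; rewrite -addr_eq0; apply/eqP.
  by rewrite -[RHS]rel; ring.
have fge s m l : m <= l%:Z * ord s f -> val_ge (ord s) m (f ^+ l).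
  by move=> le; split; [exact: FX|rewrite ordX].
have [w0 wq] : w != 0 /\ ord q w = ord q g1.
  apply: val_dominant => //; apply: val_geZ => //; apply: fge.
  by rewrite ordg1 hq fq bE; clear -ra; lia.
have Fw : F w by apply: FD => //; apply: FM => //; exact: FX.
exists w; split=> //.
- have ab0 : - (be^-1 * al) != 0 by rewrite oppr_eq0 mulf_neq0 ?invr_eq0.
  have vg : ord p (c (- (be^-1 * al)) * g) = - b%:Z.
    by case: (ordP p) => vM _ vc; rewrite vM ?fmorph_eq0 // vc // add0r.
  rewrite wE -vg; apply: (proj2 (val_dominant (ordP p) _ _ _)).
    exact: FM.
    by rewrite mulf_neq0 ?fmorph_eq0.
  rewrite vg; apply: val_ge_sum => // i _; apply: fge.
  have ia : (i * a <= n * a)%N by rewrite leq_mul2r -ltnS ltn_ord orbT.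
  by rewrite fp bE; clear -ra ia; lia.
- by rewrite wq ordg1 hq fq bE; clear -ra; lia.
- move=> s sp; have [->|sq] := eqVneq s q.
    by rewrite wq ordg1 hq fq bE; clear -ra; lia.
  have [_] : val_ge (ord s) 0 w; last exact.
  apply: val_geD => //; first by split=> // _; rewrite ordg1 fs // mulr0 addr0 hs.
  by apply: val_geZ => //; apply: fge; rewrite fs // mulr0.
Qed.

End TwoPoints.
End Valuations.

(** * The homogeneous coordinate ring and rational functions *)

Section FunctionField.
Variables (k : closedFieldType) (X : projVariety k).

Lemma clsM (g h : {mpoly k[(pdim X).+1]}) : cls X (g * h) = cls X g * cls X h.
Proof. by rewrite /cls rmorphM rmorphM. Qed.

Lemma clsD (g h : {mpoly k[(pdim X).+1]}) : cls X (g + h) = cls X g + cls X h.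
Proof. by rewrite /cls rmorphD rmorphD. Qed.

Lemma cls1 : cls X 1 = 1.
Proof. by rewrite /cls rmorph1 rmorph1. Qed.

Lemma cls_eq0 (g : {mpoly k[(pdim X).+1]}) : (cls X g == 0) = (g \in (pideal X : {pred _})).
Proof.
rewrite tofrac_eq0 -[X in _ == X](rmorph0 (\pi_(hcoord X)%qT)).
by rewrite -Quotient.idealrBE subr0.
Qed.

End FunctionField.

Section RationalFunctions.
Variables (k : closedFieldType) (X : projVariety k).
Implicit Types (f : hfrac X) (P : vpoint X).

Lemma cst_is_zmod_morphism : zmod_morphism (cst X).
Proof. by move=> g h; rewrite /cst /cls !rmorphB. Qed.

Lemma cst_is_monoid_morphism : monoid_morphism (cst X).
Proof. by split=> [|g h]; rewrite /cst ?cls1 // rmorphM clsM. Qed.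

HB.instance Definition _ := GRing.isZmodMorphism.Build
  k (hfrac X) (cst X) cst_is_zmod_morphism.
HB.instance Definition _ := GRing.isMonoidMorphism.Build
  k (hfrac X) (cst X) cst_is_monoid_morphism.

Lemma pideal_meval P (g : {mpoly k[(pdim X).+1]}) : g \in (pideal X : {pred _}) -> g.@[hom_coords P] = 0.
Proof.
case: (eqs_gen g) => gen _ /gen[c ->]; rewrite raddf_sum big1 // => j _ /=.
have /andP[_ /forallP/(_ j)/eqP eP] := valP P.
by rewrite mevalM [X in _ * X]eP mulr0.
Qed.

Lemma cls_neq0 P (g : {mpoly k[(pdim X).+1]}) : g.@[hom_coords P] != 0 -> cls X g != 0.
Proof. by apply: contra_neq => /eqP; rewrite cls_eq0 => /(pideal_meval P). Qed.

Lemma hom_coords_neq0 P : exists i, hom_coords P i != 0.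
Proof.
have /andP[/eqP dP _] := valP P; apply: contrapT => /forallNP z0.
have: vpick (val P) != 0 by rewrite vpick0 -dimv_eq0 dP.
case/eqP; apply/rowP=> i; rewrite mxE.
by apply: contrapT => /eqP; exact: (z0 i).
Qed.

Lemma ratfunP f : ratfun X f <-> exists d g h,
  [/\ g \is d.-homog, h \is d.-homog, cls X h != 0 & f = cls X g / cls X h].
Proof.
by split=> -[d [g [h [gd hd h0 ->]]]]; exists d, g, h; rewrite ?cls_eq0 in h0 *.
Qed.

Lemma ratfun_cst c : ratfun X (cst X c).
Proof.
apply/ratfunP; exists 0%N, c%:MP, 1.
rewrite dhomog1 -alg_mpolyC rpredZ ?dhomog1 // cls1 oner_neq0 divr1.
by rewrite alg_mpolyC.
Qed.

Lemma ratfunM f g : ratfun X f -> ratfun X g -> ratfun X (f * g).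
Proof.
move=> /ratfunP[d [g1 [h1 [? ? h10 ->]]]] /ratfunP[e [g2 [h2 [? ? h20 ->]]]].
apply/ratfunP; exists (d + e)%N, (g1 * g2), (h1 * h2); split.
- exact: dhomogM.
- exact: dhomogM.
- by rewrite clsM; exact: mulf_neq0 h10 h20.
- by rewrite !clsM invfM mulrACA.
Qed.

Lemma ratfunV f : ratfun X f -> ratfun X f^-1.
Proof.
move=> /ratfunP[d [g [h [gd hd h0 ->]]]]; have [g0|g0] := eqVneq (cls X g) 0.
  by rewrite g0 mul0r invr0 -(rmorph0 (cst X)); exact: ratfun_cst.
by apply/ratfunP; exists d, h, g; rewrite invf_div.
Qed.

Lemma ratfunD f g : ratfun X f -> ratfun X g -> ratfun X (f + g).
Proof.
move=> /ratfunP[d [g1 [h1 [? ? h10 ->]]]] /ratfunP[e [g2 [h2 [? ? h20 ->]]]].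
apply/ratfunP; exists (d + e)%N, (g1 * h2 + g2 * h1), (h1 * h2); split.
- by apply: rpredD; [|rewrite addnC]; exact: dhomogM.
- exact: dhomogM.
- by rewrite clsM; exact: mulf_neq0 h10 h20.
- by rewrite clsD !clsM (addf_div _ _ h10 h20).
Qed.

Lemma ratfunX f n : ratfun X f -> ratfun X (f ^+ n).
Proof.
move=> Xf; elim: n => [|n IH]; last by rewrite exprS; exact: ratfunM.
by rewrite expr0 -(rmorph1 (cst X)); exact: ratfun_cst.
Qed.

End RationalFunctions.

(** * Local rings, orders and non-gaps on a smooth curve *)

Section Curve.
Variables (k : closedFieldType) (X : smoothCurve k).
Implicit Types (f t : hfrac X) (P : vpoint X).

Lemma local_ring_ratfun P f : local_ring P f -> ratfun X f.
Proof.
move=> [d [g [h [? ? h0 ->]]]]; apply/ratfunP.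
by exists d, g, h; split; [assumption|assumption|exact: cls_neq0 h0|].
Qed.

Lemma local_ring_cst P c : local_ring P (cst X c).
Proof.
exists 0%N, c%:MP, 1; rewrite dhomog1 -alg_mpolyC rpredZ ?dhomog1 //.
by rewrite alg_mpolyC cls1 meval1 oner_neq0 divr1.
Qed.

Lemma local_ring1 P : local_ring P (1 : hfrac X).
Proof. by rewrite -(rmorph1 (cst X)); exact: local_ring_cst. Qed.

Lemma local_ringM P f g : local_ring P f -> local_ring P g -> local_ring P (f * g).
Proof.
move=> [d [g1 [h1 [? ? h10 ->]]]] [e [g2 [h2 [? ? h20 ->]]]].
exists (d + e)%N, (g1 * g2), (h1 * h2); split.
- exact: dhomogM.
- exact: dhomogM.
- by rewrite mevalM; exact: mulf_neq0 h10 h20.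
- by rewrite !clsM invfM mulrACA.
Qed.

Lemma local_ringD P f g : local_ring P f -> local_ring P g -> local_ring P (f + g).
Proof.
move=> [d [g1 [h1 [? ? h10 ->]]]] [e [g2 [h2 [? ? h20 ->]]]].
exists (d + e)%N, (g1 * h2 + g2 * h1), (h1 * h2); split.
- by apply: rpredD; [|rewrite addnC]; exact: dhomogM.
- exact: dhomogM.
- by rewrite mevalM; exact: mulf_neq0 h10 h20.
- by rewrite clsD !clsM (addf_div _ _ (cls_neq0 h10) (cls_neq0 h20)).
Qed.

(** Numerator and denominator are both divided by ['X_i ^+ d], where the coordinate ['X_i] does not
    vanish at [P]. *)
Lemma ratfun_local_frac P f : ratfun X f ->
  exists g h, [/\ local_ring P g, local_ring P h & f = g / h].
Proof.
move=> /ratfunP[d [g [h [gd hd h0 ->]]]].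
have [i Pi] := hom_coords_neq0 P.
have xd : ('X_i ^+ d : {mpoly k[(pdim X).+1]}) \is d.-homog.
  by rewrite -[X in X.-homog]mul1n; apply: dhomogMn; rewrite dhomogX;
    apply/eqP; exact: mdeg1.
have x0 : ('X_i ^+ d).@[hom_coords P] != 0.
  by rewrite rmorphXn /= mevalXU expf_neq0.
exists (cls X g / cls X ('X_i ^+ d)), (cls X h / cls X ('X_i ^+ d)); split.
- by exists d, g, ('X_i ^+ d); split; [exact: gd|exact: xd|exact: x0|].
- by exists d, h, ('X_i ^+ d); split; [exact: hd|exact: xd|exact: x0|].
- by rewrite invf_div mulrA (divfK (cls_neq0 x0)).
Qed.

Lemma local_ringN P f : local_ring P f -> local_ring P (- f).
Proof.
move=> Pf; rewrite -mulN1r -(rmorphN1 (cst X)).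
by apply: local_ringM => //; exact: local_ring_cst.
Qed.

(** Transcendence degree 1 makes [f] and [t] algebraically dependent over the constants, which
    supplies the relation for [algebraic_separated]. *)
Lemma local_ring_separated P t f :
  generates_nonunits (local_ring P) t -> t != 0 -> local_ring P f -> f != 0 ->
  exists j, forall g, local_ring P g -> f <> g * t ^+ j.
Proof.
move=> tM t0 Pf f0.
have [Pt _] := generator_nonunit (local_ring1 P) tM.
case: (curve_dim X) => _ /(_ (fun i : 'I_2 => if i == 0 then f else t)) dep.
have [p p0 px0] : exists2 p : {mpoly k[2]}, p != 0 &
    mmap (cst X) (fun i : 'I_2 => if i == 0 then f else t) p = 0.
  apply: contrapT => indep; apply: dep => [i|p p0].
    by case: ifP => _; exact: (@local_ring_ratfun P).
  by apply/negP => /eqP px0; apply: indep; exists p.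
exact: (algebraic_separated (local_ring1 P) (@local_ringN P) (@local_ringD P)
  (@local_ringM P) (local_ring_cst P) tM t0 Pf f0 p0 px0).
Qed.

Lemma ord_valuation P : is_valuation (cst X) (ratfun X) (ord P).
Proof.
have A1 := local_ring1 P; have AD := @local_ringD P; have AM := @local_ringM P.
have sep := @local_ring_separated P; have frac := @ratfun_local_frac P.
split=> [f g|n f g|x x0].
- exact: (ringvalM A1 AM sep frac).
- exact: (ringvalD A1 AD AM sep frac).
- apply: (ringval_unit A1 AM sep frac).
  split; rewrite ?fmorph_eq0 //; first exact: local_ring_cst.
  by rewrite -fmorphV; exact: local_ring_cst.
Qed.

(** Base point freeness is applied at [P] itself: a member of |mP| avoiding [P] comes from a
    function whose pole there has order exactly [m]. *)
Lemma WS_function P m : (0 < m)%N -> WS P m ->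
  exists f, [/\ ratfun X f, f != 0, ord P f = - m%:Z &
    forall S, S != P -> 0 <= ord S f].
Proof.
move=> m0 [m00|/(_ P)[D [D0 [f [Ff f0 Df]]] DP]]; first by rewrite m00 in m0.
exists f; split=> // [|S SP].
  by have := Df P; rewrite DP /mult_pt eqxx; lia.
by have := Df S; rewrite /mult_pt (negPf SP) add0r => <-.
Qed.

(** Two members of |mP| suffice: mP + div(f) avoids [P], and mP itself, given by the constant 1,
    avoids every other point. *)
Lemma function_WS P m f : ratfun X f -> f != 0 -> ord P f = - m%:Z ->
  (forall S, S != P -> 0 <= ord S f) -> WS P m.
Proof.
move=> Ff f0 fP fS; right=> S; have [->|SP] := eqVneq S P.
  exists (fun S' => mult_pt m P S' + ord S' f); last first.
    by rewrite /mult_pt eqxx fP; lia.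
  split; last by exists f.
  move=> S'; rewrite /mult_pt; case: eqP => [->|/eqP S'P]; first by rewrite fP; lia.
  by rewrite add0r fS.
exists (mult_pt m P); last by rewrite /mult_pt (negPf SP).
split; first by move=> S'; rewrite /mult_pt; case: ifP.
exists (cst X 1); rewrite fmorph_eq0 oner_neq0; split=> // [|S'].
  exact: ratfun_cst.
by case: (ord_valuation S') => _ _ ->; rewrite ?oner_neq0 ?addr0.
Qed.

End Curve.

(** * The trivial new non-gaps as pole orders at P *)

Theorem corollary8 (R : realType) (C : smoothCurve R[i]) (P Q : vpoint C)
  (a b n r : nat)
  (ha : first_nongap P a)
  (hb : first_nongap_not_multiple P a b)
  (hbnr : b = (n * a + r)%N) (hn : (1 <= n)%N) (hr : (0 < r < a)%N)
  (hab : coprime a b)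
  (hdim : linsys_dim (mult_pt ((n + 1) * a) P) (n + 2))
  (hPQ : Q <> P)
  (haQ : linsys (mult_pt a P) (mult_pt a Q))
  (hT : ~ (trivial_nongaps (a - r) a b `<=` [set m%:Z | m in WS P])) :
  WS P <> WS Q.
Proof.
move=> eqWS; apply: hT.
have [a0 WPa _] := ha; have [WPb nab _] := hb.
have b0 : (0 < b)%N by lia.
have QP : Q != P by apply/eqP.
have [_ [f [Ff f0 fE]]] := haQ.
have fP : ord P f = - a%:Z.
  by have := fE P; rewrite /mult_pt eqxx eq_sym (negPf QP); lia.
have fQ : ord Q f = a%:Z by have := fE Q; rewrite /mult_pt eqxx (negPf QP); lia.
have fS S : S != P -> S != Q -> ord S f = 0.
  by move=> SP SQ; have := fE S; rewrite /mult_pt (negPf SP) (negPf SQ); lia.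
have [g [Fg g0 gP gS]] := WS_function b0 WPb.
(* The equality of the two semigroups enters here: it makes [b] a non-gap of [Q]. *)
have [h [Fh h0 hQ hS]] : exists h, [/\ ratfun C h, h != 0, ord Q h = - b%:Z &
    forall S, S != Q -> 0 <= ord S h].
  by apply: WS_function; rewrite -?eqWS.
have [e [_ _ espan]] := hdim.
have Fc := @ratfun_cst _ C; have FD := @ratfunD _ C.
have FM := @ratfunM _ C; have FV := @ratfunV _ C; have ordP := @ord_valuation _ C.
have [w [Fw w0 wP wQ wS]] : exists w, [/\ ratfun C w, w != 0, ord P w = - b%:Z,
    ord Q w = a%:Z - r%:Z & forall S, S != P -> 0 <= ord S w].
  apply: (cusp_function Fc FD FM ordP QP hbnr hr _ Ff f0 fP fQ fS Fg g0 gP gS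
    Fh h0 hQ hS (e := e)).
  move=> u Fu uS; apply: (espan u); split; first exact: Fu.
  by move=> u0 S; exact: (uS u0 S).
move=> z [m [i [nm [m_bnd /andP[_ nm_gt] /andP[nm_le _] ->]]]].
(* This follows from n(m) <= i and m a < n(m) (a - r). It yields regularity of w^i / f^m at [Q] and,
   with a - r <= b, positivity of i b - m a. *)
have i_gt : (m * a < i * (a - r))%N by nia.
have rb : (a - r <= b)%N.
  by rewrite hbnr; clear -hn; nia.
have ib_gt : (m * a < i * b)%N by apply: leq_trans i_gt _; rewrite leq_mul2l rb orbT.
exists (i * b - m * a)%N; last by rewrite /=; clear -ib_gt; lia.
have Fwi := ratfunX i Fw; have Ffm := ratfunX m Ff.
have wi0 := expf_neq0 i w0; have fm0 := expf_neq0 m f0.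
have ordE S : ord S (w ^+ i / f ^+ m) = i%:Z * ord S w - m%:Z * ord S f.
  have [vM _ _] := ordP S.
  rewrite (vM _ _ Fwi (FV _ Ffm) wi0 (invr_neq0 fm0)) (val_inv FV (ordP S) Ffm fm0).
  by rewrite (val_expr Fc FM (ordP S) i Fw w0) (val_expr Fc FM (ordP S) m Ff f0).
apply: (function_WS (FM _ _ Fwi (FV _ Ffm)) (mulf_neq0 wi0 (invr_neq0 fm0))).
  by rewrite ordE wP fP; clear -ib_gt; lia.
(* At [Q] the order is i (a - r) - m a > 0; at the remaining points [f] has order 0 and [w] has no
   pole. *)
move=> S SP; rewrite ordE; have [->|SQ] := eqVneq S Q.
  by rewrite wQ fQ; clear -i_gt hr; nia.
by rewrite (fS S SP SQ) mulr0 subr0; move: (wS S SP); clear; nia.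
Qed.
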